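(* Let $\mathcal{X}$ and $\mathcal{A}$ be concretely order-regular categories and let $F:\mathcal{X}\to\mathcal{A}$, $G:\mathcal{A}\to\mathcal{X}$ be contravariant functors forming a dual equivalence. Assume that $F$ preserves exact squares in the sense that $(Fq)^\ast\cdot(Fp)_\ast=(Fg)_\ast\cdot(Ff)^\ast$ for every exact square $p:W\to A_1$, $q:W\to A_2$, $f:A_1\to C$, $g:A_2\to C$ in $\mathcal{X}$, that $F$ maps surjections to embeddings, and that $G$ satisfies the same two conditions (with $\mathcal{A}$ in place of $\mathcal{X}$). Then $F$ and $G$ extend to an equivalence $\overline F:\mathsf{Rel}(\mathcal{X})^{\mathrm{co}}\to\mathsf{Rel}(\mathcal{A})$, $\overline G:\mathsf{Rel}(\mathcal{A})\to\mathsf{Rel}(\mathcal{X})^{\mathrm{co}}$, where for a relation $r:X\looparrowright Y$ tabulated by a span $(p:W\to X,q:W\to Y)$ one sets $(a,b)\in\overline F r$ iff $Fp(a)\le Fq(b)$ in $FW$ (and $\overline G$ analogously). Restricting this equivalence to maps gives back the dual equivalence $(F,G)$, i.e. $\overline F(f_\ast)=(Ff)^\ast$ and $\overline G(g^\ast)=(Gg)_\ast$.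
   Context: A concretely order-regular category is a locally monotone functor $U:\mathcal{C}\to\mathsf{Pos}$ (posets and monotone maps) from a poset-enriched category such that: $U$ is order-preserving and order-reflecting on homsets; $\mathcal{C}$ has, and $U$ preserves, finite $\mathsf{Pos}$-enriched (weighted) limits; $\mathcal{C}$ has a factorisation system $(\mathcal{E},\mathcal{M})$ with $U\mathcal{E}$ the surjections and $U\mathcal{M}$ the order-embeddings, and (surjection, embedding)-factorisations of $Uf$ lift uniquely. Surjections/embeddings in $\mathcal{C}$ are arrows whose $U$-image is one. A weakening relation $R:A\looparrowright B$ of posets is a subset of $A\times B$ with $a'\le aRb\le b'\Rightarrow a'Rb'$; composition $S\cdot R$ is relational composition ($R$ first), identities are orders. For $f:A\to B$: $f_\ast=\{(a,b)\mid f(a)\le b\}$, $f^\ast=\{(b,a)\mid b\le f(a)\}$. A $\mathcal{C}$-relation $A\looparrowright B$ is a weakening relation $UA\looparrowright UB$ whose graph with its projections is the $U$-image of a span in $\mathcal{C}$ (that span ''tabulates'' it). $\mathsf{Rel}(\mathcal{C})$: objects of $\mathcal{C}$, $\mathcal{C}$-relations as arrows, inclusion order; $^{\mathrm{co}}$ reverses the homset order. A square $p:W\to A_1,q:W\to A_2,f:A_1\to C,g:A_2\to C$ is exact if $fp\le gq$ and whenever $Uf(x)\le Ug(y)$ there is $w$ with $x\le Up(w)$ and $Uq(w)\le y$. *)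

(* Defs.v *)
From Stdlib Require Export Relation_Definitions FinFun.
From Stdlib Require Import List FunctionalExtensionality PropExtensionality
  ProofIrrelevance.
Import ListNotations.

Set Implicit Arguments.
Unset Strict Implicit.
Unset Printing Implicit Defensive.

Record Poset : Type := MkPoset {
  carrier :> Type;
  le : relation carrier;
  le_order : order carrier le
}.
Arguments le {p} _ _.

Declare Scope poset_scope.
Delimit Scope poset_scope with P.
Open Scope poset_scope.
Notation "x <= y" := (le x y) : poset_scope.

Lemma le_refl (P : Poset) (x : P) : x <= x.
Proof. exact (ord_refl _ _ (le_order P) x). Qed.

Lemma le_trans (P : Poset) (x y z : P) : x <= y -> y <= z -> x <= z.
Proof. exact (ord_trans _ _ (le_order P) x y z). Qed.

Lemma le_antisym (P : Poset) (x y : P) : x <= y -> y <= x -> x = y.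
Proof. exact (ord_antisym _ _ (le_order P) x y). Qed.

Record Mono (P Q : Poset) : Type := MkMono {
  mono_fun :> P -> Q;
  mono_le : forall x y, x <= y -> mono_fun x <= mono_fun y
}.

Lemma mono_ext (P Q : Poset) (f g : Mono P Q) : (forall x, f x = g x) -> f = g.
Proof.
  destruct f as [f hf], g as [g hg]; cbn; intros h.
  assert (f = g) by (apply functional_extensionality; exact h); subst g.
  f_equal; apply proof_irrelevance.
Qed.

Definition mono_poset (P Q : Poset) : Poset.
Proof.
  refine (@MkPoset (Mono P Q) (fun f g => forall x, f x <= g x) _).
  split.
  - intros f x; apply le_refl.
  - intros f g h fg gh x; eapply le_trans; eauto.
  - intros f g fg gf; apply mono_ext; intros x; apply le_antisym; auto.
Defined.

Definition mono_id (P : Poset) : Mono P P :=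
  @MkMono P P (fun x => x) (fun _ _ h => h).

Definition mono_comp (P Q R : Poset) (g : Mono Q R) (f : Mono P Q) : Mono P R :=
  @MkMono P R (fun x => g (f x)) (fun _ _ h => mono_le g (mono_le f h)).

Definition order_embedding (P Q : Poset) (m : Mono P Q) : Prop :=
  forall x y, x <= y <-> m x <= m y.

Definition op_poset (P : Poset) : Poset.
Proof.
  refine (@MkPoset P (fun x y => y <= x) _).
  split.
  - intros x; apply le_refl.
  - intros x y z xy yz; eapply le_trans; eauto.
  - intros x y xy yx; apply le_antisym; auto.
Defined.

Record PCat : Type := MkPCat {
  ob :> Type;
  hom : ob -> ob -> Poset;
  idm : forall A, hom A A;
  comp : forall A B C, hom B C -> hom A B -> hom A C;
  comp_mono : forall A B C (g g' : hom B C) (f f' : hom A B),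
    g <= g' -> f <= f' -> comp g f <= comp g' f';
  comp_assoc : forall A B C D (h : hom C D) (g : hom B C) (f : hom A B),
    comp h (comp g f) = comp (comp h g) f;
  comp_idl : forall A B (f : hom A B), comp (idm B) f = f;
  comp_idr : forall A B (f : hom A B), comp f (idm A) = f
}.
Arguments hom {p} _ _.
Arguments idm {p} _.
Arguments comp {p A B C} _ _.
Notation "g \o f" := (comp g f) (at level 50, left associativity) : poset_scope.

Definition Pos : PCat.
Proof.
  refine (@MkPCat Poset mono_poset mono_id mono_comp _ _ _ _).
  - intros A B C g g' f f' hg hf x; cbn.
    eapply le_trans; [apply hg | apply mono_le, hf].
  - intros; apply mono_ext; reflexivity.
  - intros; apply mono_ext; reflexivity.
  - intros; apply mono_ext; reflexivity.
Defined.

Definition co (C : PCat) : PCat.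
Proof.
  refine (@MkPCat C (fun A B => op_poset (hom A B)) (@idm C) (@comp C) _ _ _ _).
  - intros A B D g g' f f' hg hf; exact (comp_mono hg hf).
  - apply comp_assoc.
  - apply comp_idl.
  - apply comp_idr.
Defined.

Definition is_iso (C : PCat) (A B : C) (f : hom A B) : Prop :=
  exists g : hom B A, g \o f = idm A /\ f \o g = idm B.

Record is_pfunctor (C D : PCat) (o : C -> D)
    (m : forall A B : C, hom A B -> hom (o A) (o B)) : Prop := {
  pf_mono : forall A B (f g : hom A B), f <= g -> m A B f <= m A B g;
  pf_id : forall A, m A A (idm A) = idm (o A);
  pf_comp : forall A B E (g : hom B E) (f : hom A B),
    m A E (g \o f) = m B E g \o m A B f
}.

Record PFunctor (C D : PCat) : Type := MkPFunctor {
  fobj :> C -> D;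
  fmap : forall A B : C, hom A B -> hom (fobj A) (fobj B);
  fmapP : is_pfunctor fmap
}.
Arguments fmap {C D} p {A B} _.

Definition pfunctor_comp (C D E : PCat) (G : PFunctor D E) (F : PFunctor C D) :
  PFunctor C E.
Proof.
  refine (@MkPFunctor C E (fun A => G (F A)) (fun A B f => fmap G (fmap F f)) _).
  split.
  - intros A B f g h; apply (pf_mono (fmapP G)), (pf_mono (fmapP F)), h.
  - intros A; rewrite (pf_id (fmapP F)); apply (pf_id (fmapP G)).
  - intros A B H g f; rewrite (pf_comp (fmapP F)); apply (pf_comp (fmapP G)).
Defined.

Definition is_equivalence (C D : PCat) (F : PFunctor C D) (G : PFunctor D C) :
    Prop :=
  (exists eta : forall A : C, hom A (G (F A)),
      (forall A, is_iso (eta A)) /\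
      (forall A B (f : hom A B), eta B \o f = fmap G (fmap F f) \o eta A)) /\
  (exists eps : forall A : D, hom A (F (G A)),
      (forall A, is_iso (eps A)) /\
      (forall A B (f : hom A B), eps B \o f = fmap F (fmap G f) \o eps A)).

(* Local monotonicity is not part of the definition. *)
Record ContraFunctor (C D : PCat) : Type := MkContraFunctor {
  cobj :> C -> D;
  cmap : forall A B : C, hom A B -> hom (cobj B) (cobj A);
  cmap_id : forall A, cmap (idm A) = idm (cobj A);
  cmap_comp : forall A B E (g : hom B E) (f : hom A B),
    cmap (g \o f) = cmap f \o cmap g
}.
Arguments cmap {C D} c {A B} _.

Definition dual_equivalence (C D : PCat)
    (F : ContraFunctor C D) (G : ContraFunctor D C) : Prop :=
  (exists eta : forall A : C, hom A (G (F A)),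
      (forall A, is_iso (eta A)) /\
      (forall A B (f : hom A B), eta B \o f = cmap G (cmap F f) \o eta A)) /\
  (exists eps : forall A : D, hom A (F (G A)),
      (forall A, is_iso (eps A)) /\
      (forall A B (f : hom A B), eps B \o f = cmap F (cmap G f) \o eps A)).

(* A [Cylinder W T L] is a Pos-natural transformation from the weight [W] to
   [hom L (T -)]. *)
Record Cylinder (D C : PCat) (W : PFunctor D Pos) (T : PFunctor D C) (L : C) :
    Type := MkCylinder {
  cyl :> forall d : D, Mono (W d) (hom L (T d));
  cyl_nat : forall (d d' : D) (u : hom d d') (x : carrier (W d)),
    cyl d' (mono_fun (fmap W u) x) = fmap T u \o cyl d x
}.

(* For every [X], composition with the cylinder is an order isomorphism from
   [hom X L] to the poset of cylinders with vertex [X]; it is always monotone,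
   so it remains that it is onto and order-reflecting. *)
Definition is_limit (D C : PCat) (W : PFunctor D Pos) (T : PFunctor D C) (L : C)
    (lam : Cylinder W T L) : Prop :=
  forall X : C,
    (forall mu : Cylinder W T X,
       exists h : hom X L, forall d x, mu d x = lam d x \o h) /\
    (forall h k : hom X L,
       (forall d x, lam d x \o h <= lam d x \o k) -> h <= k).

Definition cylinder_map (D C E : PCat) (U : PFunctor C E) (W : PFunctor D Pos)
    (T : PFunctor D C) (L : C) (lam : Cylinder W T L) :
  Cylinder W (pfunctor_comp U T) (U L).
Proof.
  refine (@MkCylinder D E W (pfunctor_comp U T) (U L)
    (fun d => @MkMono (W d) (hom (U L) (pfunctor_comp U T d))
       (fun x => fmap U (lam d x))
       (fun x y h => pf_mono (fmapP U) (mono_le (lam d) h))) _).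
  intros d d' u x; cbn.
  rewrite cyl_nat; apply (pf_comp (fmapP U)).
Defined.

Definition finite_pcat (D : PCat) : Prop :=
  Finite D /\ forall d d' : D, Finite (hom d d').

(* Finite posets are the finitely presentable objects of Pos, so these are the
   weights of the finite limits of enriched category theory. *)
Definition finite_weight (D : PCat) (W : PFunctor D Pos) : Prop :=
  finite_pcat D /\ forall d, Finite (carrier (W d)).

Definition has_finite_limits (C : PCat) : Prop :=
  forall (D : PCat) (W : PFunctor D Pos) (T : PFunctor D C), finite_weight W ->
    exists (L : C) (lam : Cylinder W T L), is_limit lam.

Definition preserves_finite_limits (C E : PCat) (U : PFunctor C E) : Prop :=
  forall (D : PCat) (W : PFunctor D Pos) (T : PFunctor D C), finite_weight W ->
    forall (L : C) (lam : Cylinder W T L),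
      is_limit lam -> is_limit (cylinder_map U lam).

(* Orthogonality is stated for arrows only. When [M] consists of arrows that
   reflect the order under composition, the diagonals are monotone in the square,
   so that this is the same as the enriched notion. *)
Record factorisation_system (C : PCat)
    (E M : forall A B : C, hom A B -> Prop) : Prop := {
  fs_E_iso : forall A B (f : hom A B), is_iso f -> E A B f;
  fs_M_iso : forall A B (f : hom A B), is_iso f -> M A B f;
  fs_E_comp : forall A B D (g : hom B D) (f : hom A B),
    E _ _ g -> E _ _ f -> E _ _ (g \o f);
  fs_M_comp : forall A B D (g : hom B D) (f : hom A B),
    M _ _ g -> M _ _ f -> M _ _ (g \o f);
  fs_fact : forall A B (f : hom A B),
    exists (I : C) (e : hom A I) (m : hom I B), E _ _ e /\ M _ _ m /\ m \o e = f;
  fs_diag : forall A B D K (e : hom A B) (m : hom D K) (u : hom A D) (v : hom B K),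
    E _ _ e -> M _ _ m -> v \o e = m \o u ->
    exists! d : hom B D, d \o e = u /\ m \o d = v
}.

Record Factor (C : PCat) (A B : C) : Type := MkFactor {
  mid : C;
  fst_factor : hom A mid;
  snd_factor : hom mid B
}.
Arguments MkFactor {C A B} mid fst_factor snd_factor.

Definition factor_map (C D : PCat) (U : PFunctor C D) (A B : C)
    (t : Factor A B) : Factor (U A) (U B) :=
  MkFactor (U (mid t)) (fmap U (fst_factor t)) (fmap U (snd_factor t)).

Definition surjection_over (C : PCat) (U : PFunctor C Pos) (A B : C)
    (e : hom A B) : Prop :=
  Surjective (mono_fun (fmap U e)).

Definition embedding_over (C : PCat) (U : PFunctor C Pos) (A B : C)
    (m : hom A B) : Prop :=
  order_embedding (fmap U m).

(* The lifted factorisation lies strictly over the given one: the equality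
   includes [U (mid t') = mid t] as posets. *)
Definition lifts_factorisations (C : PCat) (U : PFunctor C Pos) : Prop :=
  forall (A B : C) (f : hom A B) (t : @Factor Pos (U A) (U B)),
    Surjective (mono_fun (fst_factor t)) ->
    order_embedding (snd_factor t) ->
    snd_factor t \o fst_factor t = fmap U f ->
    exists! t' : Factor A B,
      snd_factor t' \o fst_factor t' = f /\ factor_map U t' = t.

(* That [U] is order-preserving on homsets is part of [PFunctor]. *)
Record COR : Type := MkCOR {
  cat :> PCat;
  forget : PFunctor cat Pos;
  cor_reflect : forall (A B : cat) (f g : hom A B),
    fmap forget f <= fmap forget g -> f <= g;
  cor_limits : has_finite_limits cat;
  cor_preserves : preserves_finite_limits forget;
  cor_factorisation : factorisation_system
    (@surjection_over cat forget) (@embedding_over cat forget);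
  cor_lifts : lifts_factorisations forget
}.

Definition under (C : COR) (A : C) : Poset := forget C A.

Definition ufun (C : COR) (A B : C) (f : hom A B) : Mono (under A) (under B) :=
  fmap (forget C) f.

Definition surjection (C : COR) (A B : C) (e : hom A B) : Prop :=
  surjection_over (forget C) e.

Definition embedding (C : COR) (A B : C) (m : hom A B) : Prop :=
  embedding_over (forget C) m.

Definition is_weakening (P Q : Poset) (R : P -> Q -> Prop) : Prop :=
  forall a a' b b', a' <= a -> R a b -> b <= b' -> R a' b'.

Record WRel (P Q : Poset) : Type := MkWRel {
  wrel :> P -> Q -> Prop;
  wrelP : is_weakening wrel
}.

Lemma wrel_ext (P Q : Poset) (R S : WRel P Q) :
  (forall a b, R a b <-> S a b) -> R = S.
Proof.
  destruct R as [R hR], S as [S hS]; cbn; intros h.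
  assert (R = S).
  { apply functional_extensionality; intros a.
    apply functional_extensionality; intros b.
    apply propositional_extensionality, h. }
  subst S; f_equal; apply proof_irrelevance.
Qed.

Definition wrel_id (P : Poset) : WRel P P.
Proof.
  refine (@MkWRel P P (fun a b => a <= b) _).
  intros a a' b b' h1 h2 h3; eapply le_trans; [exact h1|].
  eapply le_trans; eauto.
Defined.

Definition wrel_comp (P Q R : Poset) (S : WRel Q R) (T : WRel P Q) : WRel P R.
Proof.
  refine (@MkWRel P R (fun a c => exists b, T a b /\ S b c) _).
  intros a a' c c' ha [b [hT hS]] hc; exists b; split.
  - exact (wrelP ha hT (le_refl b)).
  - exact (wrelP (le_refl b) hS hc).
Defined.

Definition wrel_lower (P Q : Poset) (f : Mono P Q) : WRel P Q.
Proof.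
  refine (@MkWRel P Q (fun a b => f a <= b) _).
  intros a a' b b' ha h hb; eapply le_trans; [apply mono_le, ha|].
  eapply le_trans; eauto.
Defined.

Definition wrel_upper (P Q : Poset) (f : Mono P Q) : WRel Q P.
Proof.
  refine (@MkWRel Q P (fun b a => b <= f a) _).
  intros b b' a a' hb h ha; eapply le_trans; [exact hb|].
  eapply le_trans; [exact h|]; apply mono_le, ha.
Defined.

(* The graph is ordered as a subposet of the product [P * Q]. *)
Definition graph_poset (P Q : Poset) (R : WRel P Q) : Poset.
Proof.
  refine (@MkPoset {ab : P * Q | R (fst ab) (snd ab)}
    (fun x y => fst (proj1_sig x) <= fst (proj1_sig y) /\
                snd (proj1_sig x) <= snd (proj1_sig y)) _).
  split.
  - intros x; split; apply le_refl.
  - intros x y z [h1 h2] [k1 k2]; split; eapply le_trans; eauto.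
  - intros [[a b] h] [[a' b'] h'] [h1 h2] [k1 k2]; cbn in *.
    assert (a = a') by (apply le_antisym; auto).
    assert (b = b') by (apply le_antisym; auto).
    subst a' b'; f_equal; apply proof_irrelevance.
Defined.

Definition graph_fst (P Q : Poset) (R : WRel P Q) : Mono (graph_poset R) P :=
  @MkMono (graph_poset R) P (fun x => fst (proj1_sig x)) (fun _ _ h => proj1 h).

Definition graph_snd (P Q : Poset) (R : WRel P Q) : Mono (graph_poset R) Q :=
  @MkMono (graph_poset R) Q (fun x => snd (proj1_sig x)) (fun _ _ h => proj2 h).

Record Span (C : PCat) (A B : C) : Type := MkSpan {
  apex : C;
  leg1 : hom apex A;
  leg2 : hom apex B
}.
Arguments MkSpan {C A B} apex leg1 leg2.

Definition span_map (C D : PCat) (U : PFunctor C D) (A B : C)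
    (s : Span A B) : Span (U A) (U B) :=
  MkSpan (U (apex s)) (fmap U (leg1 s)) (fmap U (leg2 s)).

Definition graph_span (P Q : Pos) (R : WRel P Q) : Span P Q :=
  @MkSpan Pos P Q (graph_poset R) (graph_fst R) (graph_snd R).

Definition tabulates (C : COR) (A B : C) (s : Span A B)
    (R : WRel (under A) (under B)) : Prop :=
  span_map (forget C) s = graph_span R.

Record CRel (C : COR) (A B : C) : Type := MkCRel {
  crel :> WRel (under A) (under B);
  crelP : exists s : Span A B, tabulates s crel
}.

Lemma crel_ext (C : COR) (A B : C) (R S : CRel A B) :
  (forall a b, R a b <-> S a b) -> R = S.
Proof.
  destruct R as [R hR], S as [S hS]; intros h.
  assert (R = S) by (apply wrel_ext; exact h); subst S.
  f_equal; apply proof_irrelevance.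
Qed.

Definition prop_poset (Q : Prop) : Poset.
Proof.
  refine (@MkPoset Q (fun _ _ => True) _).
  split; [intros x; exact I | intros x y z _ _; exact I |].
  intros x y _ _; exact (proof_irrelevance Q x y).
Defined.

Definition thin (O : Type) (Q : O -> O -> Prop) (r : forall i, Q i i)
    (t : forall i j k, Q j k -> Q i j -> Q i k) : PCat.
Proof.
  refine (@MkPCat O (fun i j => prop_poset (Q i j)) r t _ _ _ _);
    intros; first [exact I | exact (proof_irrelevance (Q _ _) _ _)].
Defined.

Definition unit_poset : Poset.
Proof.
  refine (@MkPoset unit (fun _ _ => True) _).
  split; [intros x; exact I | intros x y z _ _; exact I |].
  intros [] [] _ _; reflexivity.
Defined.

Definition two_poset : Poset.
Proof.
  refine (@MkPoset bool (fun x y => x = true -> y = true) _).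
  split.
  - intros x h; exact h.
  - intros x y z h k e; auto.
  - intros [] [] h k; try reflexivity; [symmetry; auto | auto].
Defined.

Inductive cospan_ob : Set := cs_l | cs_r | cs_m.

Definition cospan_rel (i j : cospan_ob) : Prop :=
  match i, j with
  | cs_l, cs_l | cs_r, cs_r | _, cs_m => True
  | _, _ => False
  end.

Definition cospan : PCat.
Proof.
  refine (@thin cospan_ob cospan_rel _ _).
  - intros []; exact I.
  - intros [] [] []; cbn; tauto.
Defined.

Definition cospan_functor (C : PCat) (A B K : C) (f : hom A K) (g : hom B K) :
  PFunctor cospan C.
Proof.
  set (o := fun i : cospan =>
    match i with cs_l => A | cs_r => B | cs_m => K end).
  refine (@MkPFunctor cospan C o
    (fun i j : cospan_ob =>
       match i, j return cospan_rel i j -> hom (o i) (o j) with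
       | cs_l, cs_l => fun _ => idm A
       | cs_r, cs_r => fun _ => idm B
       | cs_m, cs_m => fun _ => idm K
       | cs_l, cs_m => fun _ => f
       | cs_r, cs_m => fun _ => g
       | _, _ => fun h => False_rect _ h
       end) _).
  split.
  - intros [] [] u v _; cbn in *; try contradiction; apply le_refl.
  - intros []; reflexivity.
  - intros [] [] [] v u; cbn in *; try contradiction; symmetry;
      first [apply comp_idl | apply comp_idr].
Defined.

Definition mono_const (P Q : Poset) (y : Q) : Mono P Q :=
  @MkMono P Q (fun _ => y) (fun _ _ _ => le_refl y).

Definition comma_weight : PFunctor cospan Pos :=
  @cospan_functor Pos unit_poset unit_poset two_poset
    (mono_const unit_poset (false : two_poset))
    (mono_const unit_poset (true : two_poset)).

Lemma comma_weight_finite : finite_weight comma_weight.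
Proof.
  split; [split|].
  - exists [cs_l; cs_r; cs_m]; intros []; cbn; tauto.
  - intros [] []; cbn;
      first [exists [I]; intros []; cbn; tauto | exists []; intros []].
  - intros []; cbn.
    + exists [tt]; intros []; cbn; tauto.
    + exists [tt]; intros []; cbn; tauto.
    + exists [true; false]; intros []; cbn; tauto.
Qed.

Definition cs_left : @hom cospan cs_l cs_m := I.
Definition cs_right : @hom cospan cs_r cs_m := I.

Lemma fmap_id_comp (D C : PCat) (T : PFunctor D C) (d : D) (X : C)
    (x : hom X (T d)) : x = fmap T (idm d) \o x.
Proof. rewrite (pf_id (fmapP T)); symmetry; apply comp_idl. Qed.

Definition two_mono (P : Poset) (x y : P) (h : x <= y) : Mono two_poset P.
Proof.
  refine (@MkMono two_poset P (fun b : bool => if b then y else x) _).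
  intros [] [] e; try apply le_refl; auto.
  discriminate (e eq_refl).
Defined.

Definition comma_cylinder (C : PCat) (T : PFunctor cospan C) (X : C)
    (p : hom X (T cs_l)) (q : hom X (T cs_r))
    (h : fmap T cs_left \o p <= fmap T cs_right \o q) :
  Cylinder comma_weight T X.
Proof.
  refine (@MkCylinder cospan C comma_weight T X
    (fun i : cospan_ob =>
       match i return Mono (comma_weight i) (hom X (T i)) with
       | cs_l => mono_const unit_poset p
       | cs_r => mono_const unit_poset q
       | cs_m => two_mono h
       end) _).
  intros [] [] u x; cbn in u; try contradiction; destruct u;
    first [reflexivity | exact (fmap_id_comp _)].
Defined.

Lemma comma_exists (C : COR) (A B K : C) (f : hom A K) (g : hom B K) :
  exists s : Span A B, f \o leg1 s <= g \o leg2 s /\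
    forall x y, ufun f x <= ufun g y ->
      exists w, ufun (leg1 s) w = x /\ ufun (leg2 s) w = y.
Proof.
  destruct (cor_limits (cospan_functor f g) comma_weight_finite) as [L [lam hl]].
  pose proof (cor_preserves comma_weight_finite hl) as hU.
  exists (@MkSpan C A B L (lam cs_l tt) (lam cs_r tt)); cbn [leg1 leg2].
  split.
  - pose proof (cyl_nat lam cs_left tt) as e1.
    pose proof (cyl_nat lam cs_right tt) as e2.
    change (@le (hom L K) (fmap (cospan_functor f g) cs_left \o lam cs_l tt)
                          (fmap (cospan_functor f g) cs_right \o lam cs_r tt)).
    rewrite <- e1, <- e2.
    apply (mono_le (lam cs_m)); intros e; reflexivity.
  - intros x y hxy.
    destruct (hU unit_poset) as [hex _].
    destruct (hex (@comma_cylinder Pos (pfunctor_comp (forget C) (cospan_functor f g))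
      unit_poset (mono_const unit_poset x) (mono_const unit_poset y)
      (fun _ => hxy))) as [h hh].
    exists (mono_fun h tt); split.
    + exact (f_equal (fun m : Mono unit_poset (under A) => m tt)
        (eq_sym (hh cs_l tt))).
    + exact (f_equal (fun m : Mono unit_poset (under B) => m tt)
        (eq_sym (hh cs_r tt))).
Qed.

Definition disc2 : PCat :=
  @thin bool (@eq bool) (@eq_refl bool) (fun _ _ _ e e' => eq_trans e' e).

Definition disc2_functor (C : PCat) (A B : C) : PFunctor disc2 C.
Proof.
  set (o := fun b : disc2 => if b : bool then A else B).
  refine (@MkPFunctor disc2 C o
    (fun (i j : bool) (e : i = j) =>
       match e in _ = k return hom (o i) (o k) with eq_refl => idm (o i) end) _).
  split.
  - intros i j u v _; rewrite (proof_irrelevance (i = j) u v); apply le_refl.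
  - reflexivity.
  - intros i j k v u; cbn in *; destruct u, v; symmetry; apply comp_idl.
Defined.

Definition prod_weight : PFunctor disc2 Pos :=
  @disc2_functor Pos unit_poset unit_poset.

Lemma prod_weight_finite : finite_weight prod_weight.
Proof.
  split; [split|].
  - exists [true; false]; intros []; cbn; tauto.
  - intros [] []; cbn.
    + exists [eq_refl]; intros u; left; apply proof_irrelevance.
    + exists []; intros u; discriminate u.
    + exists []; intros u; discriminate u.
    + exists [eq_refl]; intros u; left; apply proof_irrelevance.
  - intros []; exists [tt]; intros []; cbn; tauto.
Qed.

Definition prod_cylinder (C : PCat) (T : PFunctor disc2 C) (X : C)
    (p : hom X (T true)) (q : hom X (T false)) : Cylinder prod_weight T X.
Proof.
  refine (@MkCylinder disc2 C prod_weight T X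
    (fun i : bool =>
       match i return Mono (prod_weight i) (hom X (T i)) with
       | true => mono_const unit_poset p
       | false => mono_const unit_poset q
       end) _).
  intros i j u x; cbn in u; destruct u.
  destruct i; exact (fmap_id_comp _).
Defined.

Lemma product_exists (C : COR) (A B : C) :
  exists s : Span A B,
    (forall t : Span A B, exists h : hom (apex t) (apex s),
       leg1 s \o h = leg1 t /\ leg2 s \o h = leg2 t) /\
    (forall (P : Poset) (a : Mono P (under A)) (b : Mono P (under B)),
       exists h : Mono P (under (apex s)),
         (forall x, ufun (leg1 s) (h x) = a x) /\
         (forall x, ufun (leg2 s) (h x) = b x)) /\
    (forall z z', ufun (leg1 s) z <= ufun (leg1 s) z' ->
       ufun (leg2 s) z <= ufun (leg2 s) z' -> z <= z').
Proof.
  destruct (cor_limits (disc2_functor A B) prod_weight_finite) as [L [lam hl]].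
  pose proof (cor_preserves prod_weight_finite hl) as hU.
  exists (@MkSpan C A B L (lam true tt) (lam false tt)); cbn [leg1 leg2 apex].
  repeat split.
  - intros [W p q]; cbn.
    destruct (hl W) as [hex _].
    destruct (hex (@prod_cylinder C (disc2_functor A B) W p q)) as [h hh].
    exists h; split; symmetry; [exact (hh true tt) | exact (hh false tt)].
  - intros P a b.
    destruct (hU P) as [hex _].
    destruct (hex (@prod_cylinder Pos (pfunctor_comp (forget C) (disc2_functor A B))
      P a b)) as [h hh].
    exists h; split; intros x.
    + exact (f_equal (fun m : Mono P (under A) => m x) (eq_sym (hh true tt))).
    + exact (f_equal (fun m : Mono P (under B) => m x) (eq_sym (hh false tt))).
  - intros z z' h1 h2.
    destruct (hU unit_poset) as [_ href].
    refine (href (mono_const unit_poset z) (mono_const unit_poset z') _ tt).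
    intros [] [] x; [exact h1 | exact h2].
Qed.

Lemma image_tabulated (C : COR) (A B : C) (t : Span A B)
    (R : WRel (under A) (under B)) :
  (forall w, R (ufun (leg1 t) w) (ufun (leg2 t) w)) ->
  (forall a b, R a b -> exists w, ufun (leg1 t) w = a /\ ufun (leg2 t) w = b) ->
  exists s : Span A B, tabulates s R.
Proof.
  intros hR1 hR2.
  destruct (product_exists A B) as [s [hs1 [hs2 hs3]]].
  destruct (hs1 t) as [h [h1 h2]].
  destruct (hs2 (graph_poset R) (graph_fst R) (graph_snd R)) as [m [m1 m2]].
  set (e := @MkMono (under (apex t)) (graph_poset R)
    (fun w => exist _ (ufun (leg1 t) w, ufun (leg2 t) w) (hR1 w))
    (fun w w' hw => conj (mono_le (ufun (leg1 t)) hw) (mono_le (ufun (leg2 t)) hw))).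
  assert (c1 : forall w, ufun (leg1 s) (ufun h w) = ufun (leg1 t) w).
  { intros w; rewrite <- h1; symmetry.
    exact (f_equal (fun k : Mono _ _ => k w) (pf_comp (fmapP (forget C)) _ _)). }
  assert (c2 : forall w, ufun (leg2 s) (ufun h w) = ufun (leg2 t) w).
  { intros w; rewrite <- h2; symmetry.
    exact (f_equal (fun k : Mono _ _ => k w) (pf_comp (fmapP (forget C)) _ _)). }
  destruct (@cor_lifts C _ _ h (@MkFactor Pos _ _ (graph_poset R) e m))
    as [t' [[_ ht'] _]].
  - intros [[a b] r]; destruct (hR2 a b r) as [w [ha hb]]; exists w.
    cbn in ha, hb; subst a b; cbn; f_equal; apply proof_irrelevance.
  - intros x y; split; [apply mono_le |]; cbn; intros hxy.
    pose proof (mono_le (ufun (leg1 s)) hxy) as k1.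
    pose proof (mono_le (ufun (leg2 s)) hxy) as k2.
    rewrite !m1 in k1; rewrite !m2 in k2; split; assumption.
  - apply mono_ext; intros w; change (m (e w) = ufun h w).
    apply le_antisym; apply hs3; rewrite ?m1, ?m2, ?c1, ?c2; apply le_refl.
  - exists (MkSpan (mid t') (leg1 s \o snd_factor t') (leg2 s \o snd_factor t')).
    unfold tabulates, span_map; cbn [apex leg1 leg2].
    rewrite !(pf_comp (fmapP (forget C))).
    transitivity (@MkSpan Pos (forget C A) (forget C B)
      (mid (factor_map (forget C) t'))
      (fmap (forget C) (leg1 s) \o snd_factor (factor_map (forget C) t'))
      (fmap (forget C) (leg2 s) \o snd_factor (factor_map (forget C) t')));
      [reflexivity |].
    rewrite ht'; cbn [mid snd_factor]; unfold graph_span; f_equal.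
    + apply mono_ext; exact m1.
    + apply mono_ext; exact m2.
Qed.

Lemma comma_tabulated (C : COR) (A B K : C) (f : hom A K) (g : hom B K)
    (R : WRel (under A) (under B)) :
  (forall a b, R a b <-> ufun f a <= ufun g b) ->
  exists s : Span A B, tabulates s R.
Proof.
  intros hR; destruct (comma_exists f g) as [s [h1 h2]].
  apply (@image_tabulated C A B s).
  - intros w; apply hR.
    pose proof (pf_mono (fmapP (forget C)) h1) as h.
    rewrite !(pf_comp (fmapP (forget C))) in h; exact (h w).
  - intros a b r; apply h2, hR, r.
Qed.

Lemma tabulates_spec (C : COR) (A B : C) (s : Span A B)
    (R : WRel (under A) (under B)) : tabulates s R ->
  forall a b, R a b <-> exists w, ufun (leg1 s) w = a /\ ufun (leg2 s) w = b.
Proof.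
  intros h a b.
  change (R a b <-> exists w : carrier (apex (span_map (forget C) s)),
    mono_fun (leg1 (span_map (forget C) s)) w = a /\
    mono_fun (leg2 (span_map (forget C) s)) w = b).
  rewrite h; cbn; split.
  - intros r; exists (exist _ (a, b) r); split; reflexivity.
  - intros [[[a' b'] r] [ea eb]]; cbn in ea, eb; subst; exact r.
Qed.

Lemma ufun_id (C : COR) (A : C) (x : under A) : ufun (idm A) x = x.
Proof.
  exact (f_equal (fun k : Mono _ _ => k x) (pf_id (fmapP (forget C)) A)).
Qed.

Lemma ufun_comp (C : COR) (A B E : C) (g : hom B E) (f : hom A B) (x : under A) :
  ufun (g \o f) x = ufun g (ufun f x).
Proof.
  exact (f_equal (fun k : Mono _ _ => k x) (pf_comp (fmapP (forget C)) g f)).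
Qed.

Definition crel_id (C : COR) (A : C) : CRel A A.
Proof.
  refine (@MkCRel C A A (wrel_id (under A)) _).
  apply (@comma_tabulated C A A A (idm A) (idm A)).
  intros a b; rewrite !ufun_id; reflexivity.
Defined.

Definition crel_comp (C : COR) (A B E : C) (S : CRel B E) (R : CRel A B) :
  CRel A E.
Proof.
  refine (@MkCRel C A E (wrel_comp S R) _).
  destruct (crelP R) as [s hs], (crelP S) as [t ht].
  destruct (comma_exists (leg2 s) (leg1 t)) as [c [hc1 hc2]].
  apply (@image_tabulated C A E
    (MkSpan (apex c) (leg1 s \o leg1 c) (leg2 t \o leg2 c)));
    cbn [leg1 leg2 apex].
  - intros w; rewrite !ufun_comp.
    exists (ufun (leg2 s) (ufun (leg1 c) w)); split.
    + apply (tabulates_spec hs); eauto.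
    + apply (@wrelP _ _ S (ufun (leg1 t) (ufun (leg2 c) w)) _
        (ufun (leg2 t) (ufun (leg2 c) w))); [| | apply le_refl].
      * rewrite <- !ufun_comp; exact (pf_mono (fmapP (forget C)) hc1 w).
      * apply (tabulates_spec ht); eauto.
  - intros a e [b [hR hS]].
    apply (tabulates_spec hs) in hR; destruct hR as [w [ha hb]].
    apply (tabulates_spec ht) in hS; destruct hS as [v [hb' he]].
    destruct (hc2 w v) as [u [hw hv]].
    { rewrite hb, hb'; apply le_refl. }
    exists u; rewrite !ufun_comp, hw, hv; auto.
Defined.

Definition crel_poset (C : COR) (A B : C) : Poset.
Proof.
  refine (@MkPoset (CRel A B) (fun R S => forall a b, R a b -> S a b) _).
  split.
  - intros R a b r; exact r.
  - intros R S T h k a b r; auto.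
  - intros R S h k; apply crel_ext; intros a b; split; auto.
Defined.

Definition Rel (C : COR) : PCat.
Proof.
  refine (@MkPCat C (@crel_poset C) (@crel_id C) (@crel_comp C) _ _ _ _).
  - intros A B E S S' R R' hS hR a c [b [r s]]; exists b; split; auto.
  - intros A B E K T S R; apply crel_ext; intros a d; split.
    + intros [c [[b [r s]] t]]; exists b; split; [exact r | exists c; auto].
    + intros [b [r [c [s t]]]]; exists c; split; [exists b; auto | exact t].
  - intros A B R; apply crel_ext; intros a b; split.
    + intros [b' [r h]]; exact (wrelP (le_refl a) r h).
    + intros r; exists b; split; [exact r | apply le_refl].
  - intros A B R; apply crel_ext; intros a b; split.
    + intros [a' [h r]]; exact (wrelP h r (le_refl b)).
    + intros r; exists a; split; [apply le_refl | exact r].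
Defined.

Definition lower (C : COR) (A B : C) (f : hom A B) : @hom (Rel C) A B.
Proof.
  refine (@MkCRel C A B (wrel_lower (ufun f)) _).
  apply (@comma_tabulated C A B B f (idm B)).
  intros a b; rewrite ufun_id; reflexivity.
Defined.

Definition upper (C : COR) (A B : C) (f : hom A B) : @hom (Rel C) B A.
Proof.
  refine (@MkCRel C B A (wrel_upper (ufun f)) _).
  apply (@comma_tabulated C B A B (idm B) f).
  intros b a; rewrite ufun_id; reflexivity.
Defined.

Definition exact_square (C : COR) (W A1 A2 K : C)
    (p : hom W A1) (q : hom W A2) (f : hom A1 K) (g : hom A2 K) : Prop :=
  f \o p <= g \o q /\
  forall x y, ufun f x <= ufun g y ->
    exists w, x <= ufun p w /\ ufun q w <= y.

Definition preserves_exact_squares (C D : COR) (F : ContraFunctor C D) : Prop :=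
  forall (W A1 A2 K : C)
    (p : hom W A1) (q : hom W A2) (f : hom A1 K) (g : hom A2 K),
    exact_square p q f g ->
    upper (cmap F q) \o lower (cmap F p) = lower (cmap F g) \o upper (cmap F f).

Definition surjections_to_embeddings (C D : COR) (F : ContraFunctor C D) : Prop :=
  forall (A B : C) (e : hom A B), surjection e -> embedding (cmap F e).

Definition extension_formula (C D : COR) (F : ContraFunctor C D)
    (Fbar : forall A B : C, @hom (Rel C) A B -> @hom (Rel D) (F A) (F B)) : Prop :=
  forall (A B : C) (r : @hom (Rel C) A B) (W : C) (p : hom W A) (q : hom W B),
    tabulates (MkSpan W p q) r ->
    forall (a : under (F A)) (b : under (F B)),
      crel (Fbar A B r) a b <-> ufun (cmap F p) a <= ufun (cmap F q) b.

(* Main.v *)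
(** Write [image s r] when the [C]-relation [r] is the set of pairs
    [(Up w, Uq w)] of a span [s = (p, q)].  The pairs [(a, b)] with
    [Fp a <= Fq b] depend, antitonically, only on the image of [s]: if the image
    of [t] is contained in that of [s], the pullback of the two spans projects
    surjectively onto the apex of [t], and [F] turns this surjection into an
    embedding.  So the extension of [F] may be computed from any span with the
    right image, not just from the tabulation.  Comma squares are exact, which
    gives the values on [f_*] and [f^*] and, since [S . R] is the image of the
    comma of the two inner legs, functoriality.  Finally every relation is
    [q_* . p^*] for its tabulation [(p, q)], so naturality of the unit on
    relations reduces to its naturality on maps. *)

Require Import Defs.
From Stdlib Require Import List.
Import ListNotations.

Set Implicit Arguments.
Unset Strict Implicit.
Unset Printing Implicit Defensive.

(** * Pullbacks, images of spans and exact comma squares *)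

Definition pullback_weight : PFunctor cospan Pos :=
  @cospan_functor Pos unit_poset unit_poset unit_poset
    (mono_id unit_poset) (mono_id unit_poset).

Lemma pullback_weight_finite : finite_weight pullback_weight.
Proof.
  split; [exact (proj1 comma_weight_finite)|].
  intros []; exists [tt]; intros []; cbn; tauto.
Qed.

Definition pullback_cylinder (C : PCat) (T : PFunctor cospan C) (X : C)
    (p : hom X (T cs_l)) (q : hom X (T cs_r))
    (h : fmap T cs_left \o p = fmap T cs_right \o q) :
  Cylinder pullback_weight T X.
Proof.
  refine (@MkCylinder cospan C pullback_weight T X
    (fun i : cospan_ob =>
       match i return Mono (pullback_weight i) (hom X (T i)) with
       | cs_l => mono_const unit_poset p
       | cs_r => mono_const unit_poset q
       | cs_m => mono_const unit_poset (fmap T cs_left \o p)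
       end) _).
  intros [] [] u x; cbn in u; try contradiction; destruct u;
    first [reflexivity | exact h | exact (fmap_id_comp _)].
Defined.

(** [U] preserves the limit, and points of a poset are maps from the one-point poset, so every
    compatible pair of points comes from the apex. *)
Lemma pullback_exists (C : COR) (A B K : C) (f : hom A K) (g : hom B K) :
  exists s : Span A B, f \o leg1 s = g \o leg2 s /\
    forall x y, ufun f x = ufun g y ->
      exists w, ufun (leg1 s) w = x /\ ufun (leg2 s) w = y.
Proof.
  destruct (cor_limits (cospan_functor f g) pullback_weight_finite)
    as [L [lam hl]].
  pose proof (cor_preserves pullback_weight_finite hl) as hU.
  exists (@MkSpan C A B L (lam cs_l tt) (lam cs_r tt)); cbn [leg1 leg2].
  split.
  - exact (eq_trans (eq_sym (cyl_nat lam cs_left tt)) (cyl_nat lam cs_right tt)).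
  - intros x y hxy.
    destruct (hU unit_poset) as [hex _].
    assert (e : fmap (pfunctor_comp (forget C) (cospan_functor f g)) cs_left
                  \o (mono_const unit_poset x : @hom Pos _ _)
              = fmap (pfunctor_comp (forget C) (cospan_functor f g)) cs_right
                  \o (mono_const unit_poset y : @hom Pos _ _))
      by (apply mono_ext; intros []; exact hxy).
    destruct (hex (pullback_cylinder e)) as [h hh].
    exists (mono_fun h tt); split.
    + exact (f_equal (fun m : Mono unit_poset (under A) => m tt)
        (eq_sym (hh cs_l tt))).
    + exact (f_equal (fun m : Mono unit_poset (under B) => m tt)
        (eq_sym (hh cs_r tt))).
Qed.

(** Weaker than [tabulates]: the legs need not jointly reflect the order, so spans built by
    composition qualify without being factorised first. *)
Definition image (C : COR) (A B : C) (s : Span A B)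
    (R : under A -> under B -> Prop) : Prop :=
  forall a b, R a b <-> exists w, ufun (leg1 s) w = a /\ ufun (leg2 s) w = b.

(** Mapping both spans into the product of [A] and [B] turns agreement of both legs into one
    equation, so a single pullback suffices. *)
Lemma span_pullback (C : COR) (A B : C) (s t : Span A B)
    (R S : under A -> under B -> Prop) :
  image s S -> image t R -> (forall a b, R a b -> S a b) ->
  exists (Q : C) (u : hom Q (apex t)) (v : hom Q (apex s)),
    surjection u /\ leg1 t \o u = leg1 s \o v /\ leg2 t \o u = leg2 s \o v.
Proof.
  intros hs ht hRS.
  destruct (product_exists A B) as [k [hk1 [_ hk2]]].
  destruct (hk1 t) as [m [m1 m2]], (hk1 s) as [n [n1 n2]].
  destruct (pullback_exists m n) as [c [hc1 hc2]].
  exists (apex c), (leg1 c), (leg2 c); split; [|split].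
  - intros w.
    assert (r : S (ufun (leg1 t) w) (ufun (leg2 t) w))
      by (apply hRS, ht; exists w; split; reflexivity).
    apply hs in r; destruct r as [w' [e1 e2]].
    destruct (hc2 w w') as [z [hz _]]; [|exists z; exact hz].
    rewrite <- m1, <- n1, !ufun_comp in e1; rewrite <- m2, <- n2, !ufun_comp in e2.
    (* The product projections jointly reflect the order, hence also equality. *)
    apply le_antisym; apply hk2; rewrite ?e1, ?e2; apply le_refl.
  - rewrite <- m1, <- n1, <- !comp_assoc, hc1; reflexivity.
  - rewrite <- m2, <- n2, <- !comp_assoc, hc1; reflexivity.
Qed.

Lemma comma_exact (C : COR) (A B K : C) (f : hom A K) (g : hom B K) :
  exists s : Span A B, exact_square (leg1 s) (leg2 s) f g /\
    image s (fun a b => ufun f a <= ufun g b).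
Proof.
  destruct (comma_exists f g) as [s [h1 h2]]; exists s; split; [split|].
  - exact h1.
  - intros x y h; destruct (h2 x y h) as [w [<- <-]].
    exists w; split; apply le_refl.
  - intros a b; split; [apply h2|]; intros [w [<- <-]].
    rewrite <- !ufun_comp; exact (pf_mono (fmapP (forget C)) h1 w).
Qed.

(** * Calculus of the relations [f_*] and [f^*] *)

Lemma lower_id (C : COR) (A : C) : lower (idm A) = @idm (Rel C) A.
Proof. apply crel_ext; intros a b; cbn; rewrite ufun_id; reflexivity. Qed.

Lemma lower_comp (C : COR) (A B E : C) (g : hom B E) (f : hom A B) :
  lower (g \o f) = lower g \o lower f.
Proof.
  apply crel_ext; intros a e; cbn; rewrite ufun_comp; split.
  - intros h; exists (ufun f a); split; [apply le_refl | exact h].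
  - intros [b [h k]]; exact (le_trans (mono_le (ufun g) h) k).
Qed.

Lemma upper_comp (C : COR) (A B E : C) (g : hom B E) (f : hom A B) :
  upper (g \o f) = upper f \o upper g.
Proof.
  apply crel_ext; intros e a; cbn; rewrite ufun_comp; split.
  - intros h; exists (ufun f a); split; [exact h | apply le_refl].
  - intros [b [h k]]; exact (le_trans h (mono_le (ufun g) k)).
Qed.

(** An isomorphism is left adjoint to its inverse. This trades lower for upper relations, which the
    extension interchanges. *)
Lemma lower_iso (C : COR) (A B : C) (f : hom A B) (g : hom B A) :
  g \o f = idm A -> f \o g = idm B -> lower f = upper g.
Proof.
  intros gf fg; apply crel_ext; intros a b; cbn; split; intros h.
  - apply (mono_le (ufun g)) in h; rewrite <- ufun_comp, gf, ufun_id in h; exact h.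
  - apply (mono_le (ufun f)) in h; rewrite <- ufun_comp, fg, ufun_id in h; exact h.
Qed.

Lemma tabulation_decomposition (C : COR) (A B : C) (r : @hom (Rel C) A B)
    (s : Span A B) :
  tabulates s (crel r) -> r = lower (leg2 s) \o upper (leg1 s).
Proof.
  intros hs; apply crel_ext; intros a b; cbn; split.
  - intros h; apply (tabulates_spec hs) in h; destruct h as [w [<- <-]].
    exists w; split; apply le_refl.
  - intros [w [h k]]; refine (wrelP h _ k).
    apply (tabulates_spec hs); exists w; split; reflexivity.
Qed.

(** * The extension of a contravariant functor to relations *)

Section Extension.
Context (C D : COR) (F : ContraFunctor C D).

Definition dual_rel (A B : C) (s : Span A B) (a : under (F A)) (b : under (F B)) :
    Prop :=
  ufun (cmap F (leg1 s)) a <= ufun (cmap F (leg2 s)) b.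

(** Quantified over spans because [crelP] asserts a tabulation without choosing one. *)
Definition ext_wrel (A B : C) (r : @hom (Rel C) A B) :
  WRel (under (F A)) (under (F B)).
Proof.
  refine (@MkWRel _ _ (fun a b => exists s, tabulates s (crel r) /\ dual_rel s a b) _).
  intros a a' b b' ha [s [hs h]] hb; exists s; split; [exact hs|].
  exact (le_trans (mono_le _ ha) (le_trans h (mono_le _ hb))).
Defined.

Context (hexact : preserves_exact_squares F) (hsurj : surjections_to_embeddings F).

(** By transitivity [(Fq)^* . (Fp)_*] relates [a] to [b] iff [Fp a <= Fq b]; the preservation
    equation turns this into the other composite. *)
Lemma exact_square_dual (W A1 A2 K : C)
    (p : hom W A1) (q : hom W A2) (f : hom A1 K) (g : hom A2 K) :
  exact_square p q f g -> forall a b,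
  ufun (cmap F p) a <= ufun (cmap F q) b <->
  exists c, a <= ufun (cmap F f) c /\ ufun (cmap F g) c <= b.
Proof.
  intros h a b; apply hexact in h.
  change (ufun (cmap F p) a <= ufun (cmap F q) b <->
    crel (lower (cmap F g) \o upper (cmap F f)) a b).
  rewrite <- h; cbn; split.
  - intros k; exists (ufun (cmap F p) a); split; [apply le_refl | exact k].
  - intros [c [k1 k2]]; exact (le_trans k1 k2).
Qed.

Lemma dual_rel_antitone (A B : C) (s t : Span A B)
    (R S : under A -> under B -> Prop) :
  image s S -> image t R -> (forall a b, R a b -> S a b) ->
  forall a b, dual_rel s a b -> dual_rel t a b.
Proof.
  intros hs ht hRS a b h.
  destruct (span_pullback hs ht hRS) as [Q [u [v [hu [e1 e2]]]]].
  (* [F u] is an embedding, so it suffices to compare after applying it; there the claim becomes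
     [F v] applied to [h]. *)
  apply (hsurj hu); change (ufun (cmap F u) (ufun (cmap F (leg1 t)) a) <=
                            ufun (cmap F u) (ufun (cmap F (leg2 t)) b)).
  rewrite <- !ufun_comp, <- !cmap_comp, e1, e2, !cmap_comp, !ufun_comp.
  apply mono_le, h.
Qed.

Lemma ext_wrelE (A B : C) (r : @hom (Rel C) A B) (t : Span A B) :
  image t (crel r) -> forall a b, ext_wrel r a b <-> dual_rel t a b.
Proof.
  intros ht a b; split.
  - intros [s [hs h]].
    exact (dual_rel_antitone (tabulates_spec hs) ht (fun _ _ k => k) h).
  - intros h; destruct (crelP r) as [s hs]; exists s; split; [exact hs|].
    exact (dual_rel_antitone ht (tabulates_spec hs) (fun _ _ k => k) h).
Qed.

Definition ext (A B : C) (r : @hom (Rel C) A B) : @hom (Rel D) (F A) (F B).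
Proof.
  refine (@MkCRel D (F A) (F B) (ext_wrel r) _).
  destruct (crelP r) as [s hs].
  (* The extension is the comma relation of the images of the two legs, hence tabulated in [D]. *)
  apply (@comma_tabulated D _ _ _ (cmap F (leg1 s)) (cmap F (leg2 s))).
  exact (ext_wrelE (tabulates_spec hs)).
Defined.

Lemma ext_spec (A B : C) (r : @hom (Rel C) A B) (t : Span A B) :
  image t (crel r) -> forall a b, crel (ext r) a b <-> dual_rel t a b.
Proof. exact (@ext_wrelE A B r t). Qed.

Lemma ext_antitone (A B : C) (r s : @hom (Rel C) A B) : r <= s -> ext s <= ext r.
Proof.
  intros h a b.
  destruct (crelP r) as [t ht], (crelP s) as [t' ht'].
  rewrite (ext_spec (tabulates_spec ht)), (ext_spec (tabulates_spec ht')).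
  apply (dual_rel_antitone (tabulates_spec ht') (tabulates_spec ht) h).
Qed.

(** The comma of [f] and the identity has image [f_*]; exactness evaluates its dual as [(Ff)^*]
    composed with an identity. *)
Lemma ext_lower (A B : C) (f : hom A B) : ext (lower f) = upper (cmap F f).
Proof.
  destruct (comma_exact f (idm B)) as [s [he hi]].
  apply crel_ext; intros a b.
  rewrite (@ext_spec _ _ (lower f) s).
  - unfold dual_rel; rewrite (exact_square_dual he), cmap_id; cbn; split.
    + intros [c [h k]]; rewrite ufun_id in k; exact (le_trans h (mono_le _ k)).
    + intros h; exists b; rewrite ufun_id; split; [exact h | apply le_refl].
  - intros x y; rewrite <- (hi x y), ufun_id; reflexivity.
Qed.

Lemma ext_upper (A B : C) (f : hom A B) : ext (upper f) = lower (cmap F f).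
Proof.
  destruct (comma_exact (idm B) f) as [s [he hi]].
  apply crel_ext; intros b a.
  rewrite (@ext_spec _ _ (upper f) s).
  - unfold dual_rel; rewrite (exact_square_dual he), cmap_id; cbn; split.
    + intros [c [h k]]; rewrite ufun_id in h; exact (le_trans (mono_le _ h) k).
    + intros h; exists b; rewrite ufun_id; split; [apply le_refl | exact h].
  - intros x y; rewrite <- (hi x y), ufun_id; reflexivity.
Qed.

Lemma ext_id (A : C) : ext (@idm (Rel C) A) = @idm (Rel D) (F A).
Proof.
  rewrite <- !lower_id, ext_lower, cmap_id; symmetry.
  apply lower_iso; apply comp_idl.
Qed.

Lemma ext_comp (A B E : C) (s : @hom (Rel C) B E) (r : @hom (Rel C) A B) :
  ext (s \o r) = ext s \o ext r.
Proof.
  destruct (crelP r) as [t ht], (crelP s) as [t' ht'].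
  destruct (comma_exact (leg2 t) (leg1 t')) as [c [he hi]].
  apply crel_ext; intros a e.
  rewrite (@ext_spec _ _ (s \o r)
    (MkSpan (apex c) (leg1 t \o leg1 c) (leg2 t' \o leg2 c))).
  - unfold dual_rel; cbn [leg1 leg2].
    (* Exactness of the inner comma supplies the middle point [b], related to [a] through [t] and to
       [e] through [t']. *)
    rewrite !cmap_comp, !ufun_comp, (exact_square_dual he); split.
    + intros [b [h k]]; exists b; split.
      * apply (ext_spec (tabulates_spec ht)), h.
      * apply (ext_spec (tabulates_spec ht')), k.
    + intros [b [h k]]; exists b; split.
      * apply (ext_spec (tabulates_spec ht)) in h; exact h.
      * apply (ext_spec (tabulates_spec ht')) in k; exact k.
  - intros x z; cbn [leg1 leg2 apex]; split.
    + intros [y [h k]].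
      apply (tabulates_spec ht) in h; destruct h as [w [hx hy]].
      apply (tabulates_spec ht') in k; destruct k as [w' [hy' hz]].
      destruct (proj1 (hi w w')) as [v [hv hv']].
      { rewrite hy, hy'; apply le_refl. }
      exists v; rewrite !ufun_comp, hv, hv'; split; assumption.
    + intros [v [<- <-]]; rewrite !ufun_comp.
      exists (ufun (leg2 t) (ufun (leg1 c) v)); split.
      * apply (tabulates_spec ht); eexists; split; reflexivity.
      (* The inner legs agree only up to an inequality, which weakening absorbs. *)
      * refine (wrelP (proj2 (hi (ufun (leg1 c) v) (ufun (leg2 c) v)) _) _
                  (le_refl _)).
        -- exists v; split; reflexivity.
        -- apply (tabulates_spec ht'); eexists; split; reflexivity.
Qed.

End Extension.

(** * Naturality on relations and the equivalence *)

Lemma ext_unit_natural (C D : COR) (F : ContraFunctor C D) (G : ContraFunctor D C)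
    (hFe : preserves_exact_squares F) (hFs : surjections_to_embeddings F)
    (hGe : preserves_exact_squares G) (hGs : surjections_to_embeddings G)
    (eta : forall A : C, hom A (G (F A))) :
  (forall A, is_iso (eta A)) ->
  (forall A B (f : hom A B), eta B \o f = cmap G (cmap F f) \o eta A) ->
  forall (A B : C) (r : @hom (Rel C) A B),
    lower (eta B) \o r = ext hGs (ext hFs r) \o lower (eta A).
Proof.
  intros hiso hnat A B r; destruct (crelP r) as [s hs].
  (* With [r = q_* . p^*], extending twice gives [(GFq)_* . (GFp)^*]; the factor [q_*] is handled by
     naturality of [eta] directly. *)
  rewrite (tabulation_decomposition hs).
  rewrite !ext_comp, (ext_lower hFe hFs), (ext_upper hFe hFs),
    (ext_upper hGe hGs), (ext_lower hGe hGs); try assumption.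
  rewrite comp_assoc, <- lower_comp, hnat, lower_comp, <- !comp_assoc.
  f_equal.
  (* For [p^*], replace each [eta_*] by the upper relation of its inverse; what remains is
     naturality of the inverses, [p k = l GFp]. *)
  destruct (hiso (apex s)) as [k [k1 k2]], (hiso A) as [l [l1 l2]].
  rewrite (lower_iso k1 k2), (lower_iso l1 l2), <- !upper_comp; f_equal.
  rewrite <- (comp_idr (l \o _)), <- k2, !comp_assoc, <- (comp_assoc l), <- hnat,
    comp_assoc, l1, comp_idl.
  reflexivity.
Qed.

Lemma lower_is_iso (C : COR) (A B : C) (f : hom A B) :
  is_iso f -> @is_iso (Rel C) A B (lower f).
Proof.
  intros [g [gf fg]]; exists (lower g).
  rewrite <- !lower_comp, gf, fg, !lower_id; split; reflexivity.
Qed.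

Theorem theorem7p6 (X A : COR) (F : ContraFunctor X A) (G : ContraFunctor A X)
    (hFG : dual_equivalence F G)
    (hF_exact : preserves_exact_squares F)
    (hF_surj : surjections_to_embeddings F)
    (hG_exact : preserves_exact_squares G)
    (hG_surj : surjections_to_embeddings G) :
  exists (Fbar : forall Y Z : co (Rel X),
            @hom (co (Rel X)) Y Z -> @hom (Rel A) (F Y) (F Z))
         (Gbar : forall B C : Rel A,
            @hom (Rel A) B C -> @hom (co (Rel X)) (G B) (G C))
         (hFbar : is_pfunctor Fbar) (hGbar : is_pfunctor Gbar),
    is_equivalence (MkPFunctor hFbar) (MkPFunctor hGbar) /\
    extension_formula Fbar /\
    extension_formula Gbar /\
    (forall (Y Z : X) (f : hom Y Z), Fbar Y Z (lower f) = upper (cmap F f)) /\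
    (forall (B C : A) (g : hom B C), Gbar C B (upper g) = lower (cmap G g)).
Proof.
  destruct hFG as [[eta [eta_iso eta_nat]] [eps [eps_iso eps_nat]]].
  exists (fun Y Z r => ext hF_surj r), (fun B C r => ext hG_surj r).
  unshelve eexists; [|unshelve eexists; [|split; [split|split; [|split; [|split]]]]].
  - split.
    (* Antitone for inclusion means monotone out of [co]. *)
    + intros Y Z r s h; exact (ext_antitone h).
    + exact (ext_id hF_exact hF_surj).
    + intros Y Z V s r; exact (ext_comp hF_exact hF_surj s r).
  - split.
    + intros Y Z r s h; exact (ext_antitone h).
    + exact (ext_id hG_exact hG_surj).
    + intros Y Z V s r; exact (ext_comp hG_exact hG_surj s r).
  (* [co] changes neither arrows nor composition, so isomorphisms and naturality squares of [Rel X]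
     serve unchanged. *)
  - exists (fun Y => lower (eta Y)); split.
    + intros Y; exact (lower_is_iso (eta_iso Y)).
    + exact (ext_unit_natural hF_exact hF_surj hG_exact hG_surj eta_iso eta_nat).
  - exists (fun B => lower (eps B)); split.
    + intros B; exact (lower_is_iso (eps_iso B)).
    + exact (ext_unit_natural hG_exact hG_surj hF_exact hF_surj eps_iso eps_nat).
  - intros Y Z r W p q h; exact (ext_spec hF_surj (tabulates_spec h)).
  - intros B C r W p q h; exact (ext_spec hG_surj (tabulates_spec h)).
  - exact (ext_lower hF_exact hF_surj).
  - exact (ext_upper hG_exact hG_surj).
Qed.
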